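(* Let $\mathbb{T}$ be a time scale, $a<b$ points of $\mathbb{T}$, and $I_\mathbb{T}=[a,\infty)\cap\mathbb{T}$. Let $u,f,g,h\in C_{rd}(I_\mathbb{T},\mathbb{R}_+)$ and assume $$u(t)\leq k+\int_a^tf(s)\Big[u(s)+\int_a^sg(\tau)u(\tau)\Delta\tau+\int_a^bh(\tau)u(\tau)\Delta\tau\Big]\Delta s,\quad t\in I_{\mathbb{T}},$$ where $k\geq0$ is a real constant. If $$r=\int_a^bh(\tau)\,e_{f+g}(\tau,a)\Delta \tau < 1,$$ then $$u(t)\leq \frac{k}{1-r}\,e_{f+g}(t,a),\quad t\in I_{\mathbb{T}}.$$
   Context: A time scale $\mathbb{T}$ is a nonempty closed subset of $\mathbb{R}$, with forward jump $\sigma(t)=\inf\{s\in\mathbb{T}:s>t\}$ and graininess $\mu(t)=\sigma(t)-t$. A function is rd-continuous if it is continuous at right-dense points and has finite left limits at left-dense points; $C_{rd}$ denotes such functions. $\int\cdot\,\Delta s$ is the delta (Hilger) integral. For an rd-continuous $p$ with $1+\mu(t)p(t)\neq0$, the generalized exponential is $e_p(t,s)=\exp\big(\int_s^t \xi_{\mu(\tau)}(p(\tau))\Delta\tau\big)$, where $\xi_h(z)=\log(1+hz)/h$ if $h\neq0$ and $\xi_0(z)=z$. *)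

(* Defs.v *)
From HB Require Import structures.
From mathcomp Require Import all_boot all_order all_algebra.
From mathcomp Require Import all_classical all_reals all_analysis.
Import Order.TTheory GRing.Theory Num.Theory.
Import numFieldNormedType.Exports.
Local Open Scope classical_set_scope.
Local Open Scope ring_scope.

Definition time_scale {R : realType} (T : set R) : Prop :=
  T !=set0 /\ closed T.

(* Forward jump sigma(t) = inf {s in T | s > t}, with inf of the empty set
   taken to be t (so sigma(max T) = max T). *)
Definition fjump {R : realType} (T : set R) (t : R) : R :=
  if pselect (exists s, T s /\ t < s) then inf [set s | T s /\ t < s] else t.

Definition grain {R : realType} (T : set R) (t : R) : R := fjump T t - t.

Definition right_dense {R : realType} (D : set R) (t : R) : Prop :=
  forall e : R, 0 < e -> exists s, D s /\ t < s /\ s < t + e.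
Definition left_dense {R : realType} (D : set R) (t : R) : Prop :=
  forall e : R, 0 < e -> exists s, D s /\ t - e < s /\ s < t.

Definition rd_continuous {R : realType} (D : set R) (f : R -> R) : Prop :=
  forall t, D t ->
    (right_dense D t ->
       forall e : R, 0 < e -> exists d : R, 0 < d /\
         forall s, D s -> `|s - t| < d -> `|f s - f t| < e) /\
    (left_dense D t ->
       exists l : R, forall e : R, 0 < e -> exists d : R, 0 < d /\
         forall s, D s -> t - d < s -> s < t -> `|f s - l| < e).

Definition tfloor {R : realType} (T : set R) (x : R) : R :=
  sup [set s | T s /\ s <= x].

(* Delta (Hilger) integral, realised as the Lebesgue delta-integral:
   int_a^b f Delta s = int_[a,b) f(tfloor x) dx (f extended to be constant on
   the gaps of T), with int_a^b = - int_b^a when b < a. *)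
Definition dint {R : realType} (T : set R) (f : R -> R) (a b : R) : R :=
  if a <= b then
    Rintegral (@lebesgue_measure R) `[a, b[%classic (fun x => f (tfloor T x))
  else
    - Rintegral (@lebesgue_measure R) `[b, a[%classic (fun x => f (tfloor T x)).

Definition xi {R : realType} (h z : R) : R :=
  if h == 0 then z else ln (1 + h * z) / h.

Definition gexp {R : realType} (T : set R) (p : R -> R) (t s : R) : R :=
  expR (dint T (fun tau => xi (grain T tau) (p tau)) s t).

(* Main.v *)
Require Import Defs.
From HB Require Import structures.
From mathcomp Require Import all_boot all_order all_algebra ring lra.
From mathcomp Require Import all_classical all_reals all_analysis.
From mathcomp Require Import measurable_realfun.
Import Order.TTheory GRing.Theory Num.Theory.
Import numFieldNormedType.Exports.
Local Open Scope classical_set_scope.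
Local Open Scope ring_scope.

(* Put H = int_a^b h u and z(t) = u(t) + int_a^t g u + H. The hypothesis gives
   z <= (k + H) + int_a^t (f + g) z, so Gronwall's inequality yields
   u <= z <= (k + H) e_{f+g}(., a). Feeding this bound back into H gives
   H <= r (k + H), i.e. k + H <= k / (1 - r).

   Gronwall's inequality for z <= m := K + int_a^t p z is proved by induction
   along the time scale on m(t) <= exp(eps (t - a)) K e_p(t, a): at a
   right-scattered point both sides are multiplied by at least 1 + mu p, at a
   right-dense point the rates are frozen up to eps / 4, and left-dense points
   are reached by continuity of m. Finally eps tends to 0.

   Delta integrals are Lebesgue integrals of step extensions f o tfloor;
   rd-continuity makes such an extension right-continuous, hence measurable,
   and locally bounded. *)

(** * Closed sets and right-dense points *)

Lemma closed_approx {R : realType} (T : set R) (x : R) : closed T ->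
  (forall e : R, 0 < e -> exists s, T s /\ `|s - x| < e) -> T x.
Proof.
move=> cT ax; apply: cT => A /nbhs_ballP[e /= e0 eA].
have [s [Ts sx]] := ax e e0.
by exists s; split => //; apply: eA; rewrite /ball/= distrC.
Qed.

Lemma right_dense_mem {R : realType} {T : set R} {x : R} :
  closed T -> right_dense T x -> T x.
Proof.
move=> cT dx; apply: closed_approx => // e /dx[s [Ts [xs se]]].
by exists s; split => //; rewrite ltr_norml; apply/andP; split; lra.
Qed.

Lemma not_right_dense {R : realType} (T : set R) (x : R) : ~ right_dense T x ->
  exists e : R, 0 < e /\ forall s, T s -> x < s -> x + e <= s.
Proof.
move=> /existsNP[e /not_implyP[e0 ne]]; exists e; split => // s Ts xs.
by rewrite leNgt; apply/negP => se; apply: ne; exists s.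
Qed.

(** * The floor map onto the time scale, and induction along it *)

Section floor.
Context {R : realType} {T : set R} {a : R}.
Hypotheses (cT : closed T) (Ta : T a).

Lemma tfloor_has_sup x : a <= x -> has_sup [set s | T s /\ s <= x].
Proof. by move=> ax; split; [exists a | exists x => s []]. Qed.

Lemma tfloor_le x : a <= x -> tfloor T x <= x.
Proof. by move=> /tfloor_has_sup[ne _]; apply: ge_sup => // s []. Qed.

Lemma tfloor_ge x s : T s -> s <= x -> s <= tfloor T x.
Proof. by move=> Ts sx; apply: ub_le_sup; [exists x => y [] | ]. Qed.

Lemma tfloor_mem x : a <= x -> T (tfloor T x).
Proof.
move=> ax; apply: closed_approx => // e e0.
have [s [Ts sx] es] := sup_adherent e0 (tfloor_has_sup _ ax).
exists s; split => //; have := tfloor_ge _ _ Ts sx; rewrite /tfloor => ?.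
by rewrite ltr_norml; apply/andP; split; lra.
Qed.

Lemma tfloor_eq x s : T s -> s <= x -> (forall y, T y -> y <= x -> y <= s) ->
  tfloor T x = s.
Proof.
move=> Ts sx ys; apply/eqP; rewrite eq_le tfloor_ge// andbT.
by apply: ge_sup => [|y [Ty yx]]; [exists s | exact: ys].
Qed.

Lemma tfloor_id t : T t -> tfloor T t = t.
Proof. by move=> Tt; exact: tfloor_eq. Qed.

Lemma tfloor_homo x y : a <= x -> x <= y -> tfloor T x <= tfloor T y.
Proof.
by move=> ax xy; apply: tfloor_ge; [exact: tfloor_mem|exact: le_trans (tfloor_le _ ax) xy].
Qed.

(* Real induction, adapted to a time scale. *)
Lemma time_scale_ind (A : R -> Prop) : A a ->
  (forall t s, T t -> a <= t -> T s -> t < s ->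
     (forall y, T y -> t < y -> s <= y) -> A t -> A s) ->
  (forall t, T t -> a <= t -> right_dense T t -> A t ->
     exists d : R, 0 < d /\ forall s, T s -> t < s -> s < t + d -> A s) ->
  (forall t, T t -> a < t -> left_dense T t ->
     (forall s, T s -> a <= s -> s < t -> A s) -> A t) ->
  forall t, T t -> a <= t -> A t.
Proof.
move=> A0 Ars Ard Ald t0 Tt0 at0; apply: contrapT => nA.
(* Let [i] be the infimum of the failures. It is shown that [A i] holds and that failures accumulate
   at [i] from the right, which the right-dense rule forbids. *)
pose S := [set t | T t /\ a <= t /\ ~ A t].
have hS : has_inf S by split; [exists t0 | exists a => y [_ []]].
have St0 : S t0 by [].
pose i := inf S.
have iS y : S y -> i <= y by apply: ge_inf; case: hS.
have ai : a <= i by apply: lb_le_inf; [case: hS|move=> y [_ []]].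
have Ti : T i.
  apply: closed_approx => // e e0.
  have [s Ss es] := inf_adherent e0 hS.
  exists s; split; first by case: Ss.
  by have := iS _ Ss; rewrite ltr_norml => ?; apply/andP; split; rewrite -/i in es; lra.
have Alt s : T s -> a <= s -> s < i -> A s.
  by move=> Ts as_ si; apply: contrapT => nAs; move: si; rewrite ltNge iS.
have Ai : A i.
  move: ai; rewrite le_eqVlt => /predU1P[<-//|ai].
  have [ld|/existsNP[e /not_implyP[e0 ne]]] := pselect (left_dense T i).
    exact: Ald.
  (* No point of [T] lies strictly between [i - e] and [i], so [tfloor T m] is the predecessor of
     [i]; the maximum with [a] keeps it in range. *)
  pose m := Num.max a (i - e).
  have aim : a <= m by rewrite le_max lexx.
  have mi : m < i by rewrite gt_max ai/=; lra.
  have le_m y : T y -> y < i -> y <= i - e.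
    by move=> Ty yi; rewrite leNgt; apply/negP => ey; apply: ne; exists y.
  have fm := tfloor_le _ aim.
  apply: (Ars (tfloor T m)) => //.
  - exact: tfloor_mem.
  - exact: tfloor_ge.
  - exact: le_lt_trans mi.
  - move=> y Ty my; rewrite leNgt; apply/negP => yi.
    move: my; rewrite ltNge tfloor_ge//.
    by rewrite le_max le_m// orbT.
  - by apply: Alt; [exact: tfloor_mem|exact: tfloor_ge|exact: le_lt_trans mi].
have rd : right_dense T i.
  move=> e e0; have [s Ss es] := inf_adherent e0 hS.
  exists s; split; first by case: Ss.
  split=> //; rewrite lt_neqAle iS// andbT; apply/eqP => E.
  by case: Ss => _ [_]; rewrite -E.
have [d [d0 Ad]] := Ard _ Ti ai rd Ai.
have [s Ss es] := inf_adherent d0 hS.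
have := iS _ Ss; rewrite le_eqVlt => /predU1P[E|is_].
  by case: Ss => _ [_]; rewrite -E.
by case: Ss => Ts [_]; apply; apply: Ad.
Qed.

End floor.

(** * Forward jump and graininess *)

Section jump.
Context {R : realType} {T : set R}.

Lemma fjump_ge t : t <= fjump T t.
Proof.
rewrite /fjump; case: pselect => // -[s [Ts ts]].
by apply: lb_le_inf; [exists s|move=> y [_ /ltW]].
Qed.

Lemma fjump_le t s : T s -> t < s -> fjump T t <= s.
Proof.
move=> Ts ts; rewrite /fjump; case: pselect => [?|[]] /=; last by exists s.
by apply: ge_inf => //; exists t => y [_ /ltW].
Qed.

Lemma fjump_scattered t s : T s -> t < s -> (forall y, T y -> t < y -> s <= y) ->
  fjump T t = s.
Proof.
move=> Ts ts sy; apply/eqP; rewrite eq_le fjump_le//=.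
rewrite /fjump; case: pselect => [?|[]] /=; last by exists s.
by apply: lb_le_inf => [|y [Ty /sy]]; [exists s | exact].
Qed.

Lemma grain_ge0 t : 0 <= grain T t.
Proof. by rewrite /grain subr_ge0 fjump_ge. Qed.

Lemma fjump_homo t s : T s -> t <= s -> fjump T t <= fjump T s.
Proof.
move=> Ts; rewrite le_eqVlt => /predU1P[->//|ts].
by rewrite (le_trans (fjump_le _ _ Ts ts))// fjump_ge.
Qed.

End jump.

(** * Measurability and local boundedness of step extensions *)

Lemma right_continuous_measurable {R : realType} (F : R -> R) (a : R) :
  (forall x, a <= x -> forall e : R, 0 < e ->
     exists d : R, 0 < d /\ forall y, x <= y -> y < x + d -> `|F y - F x| < e) ->
  measurable_fun `[a, +oo[ F.
Proof.
move=> rcF.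
pose k n x := Num.truncn ((x - a) * n.+1%:R).
pose F_ n x := F (a + (k n x).+1%:R / n.+1%:R).
have kP n x : a <= x -> (k n x)%:R <= (x - a) * n.+1%:R < (k n x).+1%:R.
  by move=> ax; apply: truncn_itv; rewrite mulr_ge0// subr_ge0.
apply: (@measurable_fun_cvg _ _ _ _ F_) => [n mD Y mY|x].
  rewrite (_ : _ `&` _ = \bigcup_(i in [set i | Y (F (a + i.+1%:R / n.+1%:R))])
      `[a + i%:R / n.+1%:R, a + i.+1%:R / n.+1%:R[%classic).
    by apply: bigcup_measurable => i _; exact: measurable_itv.
  apply/seteqP; split => [x/= []|x/= [i Yi]]; rewrite /= !in_itv/= ?andbT.
    move=> ax Yx; exists (k n x) => //=; rewrite in_itv/=.
    rewrite -lerBrDl -ltrBlDl ler_pdivrMr// ltr_pdivlMr//.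
    exact: kP.
  rewrite -lerBrDl -ltrBlDl ler_pdivrMr// ltr_pdivlMr// => /[dup] ii /truncn_def ik.
  split; last by rewrite /F_ /k ik.
  rewrite -subr_ge0 -(pmulr_lge0 _ (ltr0Sn R n)).
  by case/andP: ii => + _; apply: le_trans.
rewrite /= in_itv/= andbT => ax.
apply/cvgrPdist_lt => e e0; have [d [d0 Fd]] := rcF _ ax _ e0.
near=> n; rewrite /F_ distrC; have := kP n x ax => /andP[k1 k2].
have n0 : 0 < n.+1%:R :> R by [].
have nd : 1 / n.+1%:R < d.
  rewrite ltr_pdivrMr// mulrC -ltr_pdivrMr//.
  near: n; exists (Num.truncn (1 / d)) => // n /= dn.
  by rewrite (lt_le_trans (truncnS_gt _))// ler_nat ltnS.
apply: Fd.
  by rewrite -lerBlDl ler_pdivlMr// ltW.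
rewrite -ltrBrDl ltr_pdivrMr//.
rewrite -natr1 (_ : x + d - a = (x - a) + d); last by ring.
rewrite mulrDl ler_ltD// -ltr_pdivrMr//.
Unshelve. all: by end_near.
Qed.

(** This gives integrability on bounded intervals, is stable under sums and products, and holds for
    every nondecreasing function. Graininess, indefinite integrals and exponentials thus qualify
    through monotonicity alone. *)
Definition locally_dint {R : realType} (T : set R) (a : R) (f : R -> R) : Prop :=
  measurable_fun `[a, +oo[ (f \o tfloor T) /\
  forall c, exists M, forall t, T t -> a <= t -> t <= c -> `|f t| <= M.

Section locally_dint.
Context {R : realType} {T : set R} {a : R}.
Hypotheses (cT : closed T) (Ta : T a).
Let I := [set t | T t /\ a <= t].

(** Boundedness up to [t] propagates along the time scale: a jump adds one value, continuity
    controls the right of a right-dense point, and the left limit controls the left of a left-dense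
    one. *)
Lemma rd_continuous_bounded f c : rd_continuous I f ->
  exists M, forall t, T t -> a <= t -> t <= c -> `|f t| <= M.
Proof.
move=> rf; have [ca|ac] := ltP c a.
  by exists 0 => t _ at_ tc; move: (lt_le_trans ca at_); rewrite ltNge tc.
pose A t := exists M, forall s, T s -> a <= s -> s <= t -> `|f s| <= M.
suff H t : T t -> a <= t -> A t.
  have [M HM] := H _ (tfloor_mem cT Ta _ ac) (tfloor_ge _ _ Ta ac).
  by exists M => t Tt at_ tc; apply: HM => //; exact: tfloor_ge.
move: t; apply: (time_scale_ind cT Ta) => {c ac}.
- by exists `|f a| => s _ as_ sa; rewrite (_ : s = a)//; apply/eqP; rewrite eq_le sa.
- move=> t s Tt at_ Ts ts sy [M HM]; exists (Num.max M `|f s|) => y Ty ay ys.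
  have [yt|ty] := leP y t; first by rewrite le_max HM.
  by rewrite (_ : y = s) ?le_max ?lexx ?orbT//; apply/eqP; rewrite eq_le ys sy.
- move=> t Tt at_ rd [M HM].
  have rdI : right_dense I t.
    move=> e /rd[s [Ts [ts se]]]; exists s; split => //; split => //.
    exact: le_trans (ltW ts).
  have [d [d0 fd]] := (rf t (conj Tt at_)).1 rdI 1 ltr01.
  exists d; split=> // s Ts ts sd; exists (Num.max M (`|f t| + 1)) => y Ty ay ys.
  have [yt|ty] := leP y t; first by rewrite le_max HM.
  have : `|f y - f t| < 1.
    by apply: fd => //; rewrite ger0_norm; lra.
  have := ler_normD (f y - f t) (f t); rewrite subrK => ? ?.
  by rewrite le_max; apply/orP; right; lra.
- move=> t Tt at_ ld IH.
  have ldI : left_dense I t.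
    move=> e e0; have [|s [Ts [ts se]]] := ld (Num.min e (t - a)).
      by rewrite lt_min e0 subr_gt0.
    exists s; rewrite /I /=; do ?split => //.
      by have : Num.min e (t - a) <= t - a by [rewrite ge_min lexx orbT]; lra.
    by have : Num.min e (t - a) <= e by [rewrite ge_min lexx]; lra.
  have [l fl] := (rf t (conj Tt (ltW at_))).2 ldI.
  have [d [d0 fd]] := fl 1 ltr01.
  have [s [[Ts as_] [ds st]]] := ldI d d0.
  have [M HM] := IH s Ts as_ st.
  exists (Num.max (Num.max M `|f t|) (`|l| + 1)) => y Ty ay yt.
  have [ys|sy] := leP y s; first by rewrite !le_max HM.
  move: yt; rewrite le_eqVlt => /predU1P[->|yt]; first by rewrite !le_max lexx orbT.
  have : `|f y - l| < 1.
    by apply: fd => //; lra.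
  have := ler_normD (f y - l) l; rewrite subrK => ? ?.
  by rewrite le_max; apply/orP; right; lra.
Qed.

(** For right-continuity of the extension at [x]: if [x] is right-dense, the floor of a nearby
    [y >= x] lies between [x] and [y]; otherwise the floor is constant just to the right of [x]. *)
Lemma rd_continuous_locally_dint f : rd_continuous I f -> locally_dint T a f.
Proof.
move=> rf; split; last by move=> c; exact: rd_continuous_bounded.
apply: right_continuous_measurable => x ax e e0 /=.
have [rd|/not_right_dense[d [d0 Hd]]] := pselect (right_dense T x).
  have Tx := right_dense_mem cT rd.
  have rdI : right_dense I x.
    move=> ? /rd[s [Ts [xs se]]]; exists s; split => //; split => //.
    exact: le_trans (ltW xs).
  have [d [d0 fd]] := (rf x (conj Tx ax)).1 rdI e e0.
  exists d; split => // y xy yd; rewrite (tfloor_id _ Tx).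
  have ay := le_trans ax xy.
  have ye := tfloor_le Ta y ay; have xt := tfloor_ge (T := T) y x Tx xy.
  apply: fd; first by split; [exact: (tfloor_mem cT Ta)|lra].
  by rewrite ger0_norm; lra.
exists d; split => // y xy yd.
have ay := le_trans ax xy.
rewrite (_ : tfloor T y = tfloor T x) ?subrr ?normr0//.
apply: tfloor_eq; first exact: (tfloor_mem cT Ta).
  by rewrite (le_trans (tfloor_le Ta _ ax)).
move=> z Tz zy; apply: tfloor_ge => //; rewrite leNgt; apply/negP => xz.
by have := Hd _ Tz xz; lra.
Qed.

Lemma nondecreasing_locally_dint f :
  (forall s t, I s -> I t -> s <= t -> f s <= f t) -> locally_dint T a f.
Proof.
move=> nf; have ft x : a <= x -> I (tfloor T x).
  by move=> ax; split; [exact: (tfloor_mem cT Ta)|exact: tfloor_ge].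
split.
  (* Truncating at [a] gives a function that is nondecreasing on the whole line. *)
  have : measurable_fun `[a, +oo[ (fun x => f (tfloor T (Num.max a x))).
    apply: nondecreasing_measurable => // x y xy; apply: nf.
    - by apply: ft; rewrite le_max lexx.
    - by apply: ft; rewrite le_max lexx.
    - by apply: (tfloor_homo cT Ta); [rewrite le_max lexx|rewrite ge_max !le_max lexx xy orbT].
  apply: eq_measurable_fun => x; rewrite inE/= in_itv/= andbT => ax.
  by rewrite /= max_r.
move=> c; have [ca|ac] := ltP c a.
  by exists 0 => t _ at_ tc; move: (lt_le_trans ca at_); rewrite ltNge tc.
exists (Num.max `|f a| `|f (tfloor T c)|) => t Tt at_ tc.
have fat : f a <= f t by apply: nf.
have ftc : f t <= f (tfloor T c) by exact: nf _ _ (conj Tt at_) (ft _ ac) (tfloor_ge _ _ Tt tc).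
case: ger0P => _.
  rewrite le_max; apply/orP; right; exact: le_trans (ler_norm _).
rewrite le_max; apply/orP; left; rewrite -(normrN (f a)).
by apply: le_trans (ler_norm _); rewrite lerN2.
Qed.

Lemma cst_locally_dint k : locally_dint T a (cst k).
Proof. by split; [exact: measurable_cst|move=> c; exists `|k|]. Qed.

Lemma locally_dintD f g : locally_dint T a f -> locally_dint T a g ->
  locally_dint T a (f \+ g).
Proof.
move=> [mf bf] [mg bg]; split; first exact: measurable_funD.
move=> c; have [M HM] := bf c; have [N HN] := bg c.
exists (M + N) => t Tt at_ tc /=.
by rewrite (le_trans (ler_normD _ _))// lerD// (HM, HN).
Qed.

Lemma locally_dintM f g : locally_dint T a f -> locally_dint T a g ->
  locally_dint T a (f \* g).
Proof.
move=> [mf bf] [mg bg]; split; first exact: measurable_funM.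
move=> c; have [M HM] := bf c; have [N HN] := bg c.
exists (M * N) => t Tt at_ tc /=.
by rewrite normrM ler_pM// (HM, HN).
Qed.

End locally_dint.

(** * Calculus of the delta integral *)

Section dint.
Context {R : realType} {T : set R} {a : R}.
Hypotheses (cT : closed T) (Ta : T a).
Local Notation mu := (@lebesgue_measure R).

Lemma dintE f s t : s <= t ->
  dint T f s t = Rintegral mu `[s, t[%classic (fun x => f (tfloor T x)).
Proof. by rewrite /dint => ->. Qed.

Lemma locally_dint_integrable f s t : locally_dint T a f -> a <= s ->
  mu.-integrable `[s, t[%classic (EFin \o (f \o tfloor T)).
Proof.
move=> [mf bf] as_; apply: measurable_bounded_integrable => //.
- by rewrite /= lebesgue_measure_itv/=; case: ifP => // _; rewrite -EFinB ltry.
- apply: measurable_funS mf => // x; rewrite /= !in_itv/= => /andP[sx _].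
  by rewrite andbT (le_trans as_).
have [M HM] := bf t; exists M; split; first exact: num_real.
move=> N MN x /=; rewrite in_itv/= => /andP[sx xt].
have ax := le_trans as_ sx.
apply: le_trans (ltW MN); apply: HM.
- exact: (tfloor_mem cT Ta).
- exact: tfloor_ge.
- by rewrite (le_trans (tfloor_le Ta _ ax))// ltW.
Qed.

Lemma dint_cat f s t v : locally_dint T a f -> a <= s -> s <= t -> t <= v ->
  dint T f s v = dint T f s t + dint T f t v.
Proof.
move=> lf as_ st tv; rewrite !dintE ?(le_trans st)//.
rewrite (@itv_bndbnd_setU _ _ _ (BLeft t)) ?bnd_simp//.
rewrite Rintegral_setU//.
- rewrite -itv_bndbnd_setU ?bnd_simp//.
  exact: locally_dint_integrable.
- apply/disj_setPS => x [/=]; rewrite !in_itv/= => /andP[_ xt] /andP[tx _].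
  by move: xt; rewrite ltNge tx.
Qed.

Lemma dint_nil f s : dint T f s s = 0.
Proof. by rewrite dintE// set_itvco0 Rintegral_set0. Qed.

Lemma dint_cst k s t : s <= t -> dint T (cst k) s t = k * (t - s).
Proof.
move=> st; rewrite dintE// Rintegral_cst//= lebesgue_measure_itv/= lte_fin.
by move: st; rewrite le_eqVlt => /predU1P[->|->//]; rewrite ltxx subrr.
Qed.

(** Since [s] is in [T], floors of points of [[s, t[] stay in [[s, t[], so a comparison at points of
    [T] suffices. *)
Lemma dint_le f g s t : locally_dint T a f -> locally_dint T a g ->
  T s -> a <= s -> s <= t ->
  (forall y, T y -> s <= y -> y < t -> f y <= g y) ->
  dint T f s t <= dint T g s t.
Proof.
move=> lf lg Ts as_ st fg; rewrite !dintE//.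
apply: le_Rintegral => //; do ?exact: locally_dint_integrable.
move=> x /=; rewrite in_itv/= => /andP[sx xt].
have ax := le_trans as_ sx.
apply: fg; [exact: (tfloor_mem cT Ta)|exact: tfloor_ge|].
exact: le_lt_trans (tfloor_le Ta _ ax) xt.
Qed.

Lemma dint_ge0 f s t : locally_dint T a f -> T s -> a <= s -> s <= t ->
  (forall y, T y -> s <= y -> 0 <= f y) -> 0 <= dint T f s t.
Proof.
move=> lf Ts as_ st f0; rewrite -[leLHS](mul0r (t - s)) -dint_cst//.
apply: dint_le => //; first exact: cst_locally_dint.
by move=> y Ty sy _; exact: f0.
Qed.

Lemma dintD f g s t : locally_dint T a f -> locally_dint T a g ->
  a <= s -> s <= t ->
  dint T (f \+ g) s t = dint T f s t + dint T g s t.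
Proof.
move=> lf lg as_ st; rewrite !dintE// -RintegralD//;
  exact: locally_dint_integrable.
Qed.

Lemma dintZr f k s t : locally_dint T a f -> a <= s -> s <= t ->
  dint T (f \* cst k) s t = dint T f s t * k.
Proof.
move=> lf as_ st; rewrite !dintE// -RintegralZr//.
exact: locally_dint_integrable.
Qed.

(** The floor is constantly [t] on the gap [[t, s[]. *)
Lemma dint_scattered f t s : T t -> t < s -> (forall y, T y -> t < y -> s <= y) ->
  dint T f t s = f t * (s - t).
Proof.
move=> Tt ts sy; rewrite -dint_cst ?ltW// !dintE ?ltW//.
apply: eq_Rintegral => x; rewrite inE/= in_itv/= => /andP[tx xs].
congr f; apply: tfloor_eq => // y Ty yx; rewrite leNgt; apply/negP => ty.
by have := sy _ Ty ty; rewrite leNgt (le_lt_trans yx).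
Qed.

Lemma dint_locally_dint f : locally_dint T a f ->
  (forall t, T t -> a <= t -> 0 <= f t) -> locally_dint T a (dint T f a).
Proof.
move=> lf f0; apply: (nondecreasing_locally_dint cT Ta) => s t [Ts as_] [Tt at_] st.
rewrite (dint_cat _ _ _ _ lf _ as_ st)// lerDl.
apply: dint_ge0 => // y Ty sy; exact: f0 (le_trans as_ sy).
Qed.

End dint.

(** * Bounds on the cylinder transformation [xi] *)

Section xi.
Context {R : realType}.
Implicit Types h z : R.

Lemma xi_le h z : 0 <= h -> 0 <= z -> xi h z <= z.
Proof.
rewrite /xi => h0 z0; case: eqVneq => // hn0.
have hp : 0 < h by rewrite lt_neqAle eq_sym hn0.
by rewrite ler_pdivrMr// mulrC le_ln1Dx// (lt_le_trans (ltrN10 _))// mulr_ge0.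
Qed.

Lemma xi_ge0 h z : 0 <= h -> 0 <= z -> 0 <= xi h z.
Proof.
rewrite /xi => h0 z0; case: eqVneq => // hn0.
by rewrite divr_ge0// ln_ge0// lerDl mulr_ge0.
Qed.

(* ln (1 + y) >= y - y^2, from ln (1 + x) <= x at x = 1 / (1 + y) - 1. *)
Lemma xi_ge h z : 0 <= h -> 0 <= z -> z - h * z ^+ 2 <= xi h z.
Proof.
rewrite /xi => h0 z0; case: eqVneq => [->|hn0]; first by rewrite mul0r subr0.
have hp : 0 < h by rewrite lt_neqAle eq_sym hn0.
have y0 : 0 <= h * z by rewrite mulr_ge0.
have y1 : 0 < 1 + h * z by lra.
have i1 : 0 < (1 + h * z)^-1 by rewrite invr_gt0.
have iE : (1 + h * z)^-1 * (1 + h * z) = 1 by rewrite mulVf// gt_eqF.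
have := @le_ln1Dx R ((1 + h * z)^-1 - 1).
rewrite subrKC lnV ?posrE// => /(_ ltac:(lra)) L.
rewrite ler_pdivlMr//; apply: le_trans (_ : 1 - (1 + h * z)^-1 <= _); last lra.
move: i1 iE; set i := (_^-1); set y := h * z => i1 iE.
rewrite (_ : (z - h * z ^+ 2) * h = y - y ^+ 2); last by rewrite /y; ring.
(* With [i = 1 / (1 + y)], the nonnegative number [i * y ^+ 3] is exactly the gap between [1 - i]
   and [y - y ^+ 2]. *)
have := mulr_ge0 (ltW i1) (exprn_ge0 3 y0); rewrite -/y.
have iyE : i * y = 1 - i by rewrite -iE; ring.
rewrite (_ : i * y ^+ 3 = y ^+ 2 - y * (i * y)).
  by rewrite iyE mulrBr mulr1 [y * i]mulrC iyE; lra.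
by rewrite -[X in X - _]mulr1 -iE; ring.
Qed.

End xi.

(** * The generalized exponential of a nonnegative rate *)

Section exponential.
Context {R : realType} {T : set R} {a : R} {p : R -> R}.
Hypotheses (cT : closed T) (Ta : T a).
Hypotheses (lp : locally_dint T a p).
Hypothesis p0 : forall t, T t -> a <= t -> 0 <= p t.
Let q t := xi (grain T t) (p t).

(** Graininess is a difference of two nondecreasing functions, the forward jump and the identity. *)
Lemma grain_locally_dint : locally_dint T a (grain T).
Proof.
have -> : grain T = fjump T \+ (cst (-1) \* id).
  by apply/funext => t; rewrite /grain/= mulN1r.
apply: locally_dintD.
  apply: (nondecreasing_locally_dint cT Ta) => s t [_ _] [Tt _] st.
  exact: fjump_homo.
apply: locally_dintM; first exact: cst_locally_dint.
exact: (nondecreasing_locally_dint cT Ta).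
Qed.

Lemma xi_locally_dint : locally_dint T a q.
Proof.
split; last first.
  move=> c; have [M HM] := lp.2 c; exists M => t Tt at_ tc.
  apply: le_trans (HM t Tt at_ tc).
  by rewrite !ger0_norm ?xi_ge0 ?xi_le ?grain_ge0 ?p0.
have mg := grain_locally_dint.1.
have mp := lp.1.
pose G x := grain T (tfloor T x).
(* The inverse is written as a real power, a measurable function; the two agree because graininess
   is nonnegative. *)
have : measurable_fun `[a, +oo[ (fun x => if G x == 0 then p (tfloor T x) else
    ln (1 + G x * p (tfloor T x)) * G x `^ (-1)).
  apply: measurable_fun_if => //.
  - by apply: measurable_fun_eqr => //; exact: measurable_cst.
  - by apply: measurable_funS mp => // x [].
  - apply: (@measurable_funS _ _ _ _ `[a, +oo[%classic) => //; last first.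
    apply: measurable_funM.
      apply: (@measurableT_comp _ _ _ _ _ _ (@ln R) _
        (fun x => 1 + G x * p (tfloor T x))) => //.
      by apply: measurable_funD; [exact: measurable_cst|exact: measurable_funM].
    exact: (@measurableT_comp _ _ _ _ _ _ (fun x : R => x `^ (-1)) _ G).
apply: eq_measurable_fun => x _.
by rewrite /q /xi /= powR_inv1// grain_ge0.
Qed.

Lemma gexp_cat s t : a <= s -> s <= t ->
  gexp T p t a = gexp T p s a * gexp T p t s.
Proof.
move=> as_ st; rewrite /gexp -expRD.
by rewrite (dint_cat cT Ta _ _ _ _ xi_locally_dint _ as_ st).
Qed.

Lemma gexp_ge1 s t : T s -> a <= s -> s <= t -> 1 <= gexp T p t s.
Proof.
move=> Ts as_ st; rewrite /gexp -[leLHS]expR0 ler_expR.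
apply: (dint_ge0 cT Ta) => //; first exact: xi_locally_dint.
by move=> y Ty sy; rewrite xi_ge0 ?grain_ge0// p0// (le_trans as_).
Qed.

Lemma gexp_homo s t : T s -> a <= s -> s <= t -> gexp T p s a <= gexp T p t a.
Proof.
move=> Ts as_ st; rewrite (gexp_cat s t)// ler_peMr ?expR_ge0//.
exact: gexp_ge1.
Qed.

Lemma gexp_locally_dint : locally_dint T a (gexp T p ^~ a).
Proof.
apply: (nondecreasing_locally_dint cT Ta) => s t [Ts as_] _ st.
exact: gexp_homo.
Qed.

(** The integral over the gap is [(s - t) * xi (s - t) (p t)], that is [ln (1 + (s - t) * p t)]. *)
Lemma gexp_scattered t s : T t -> a <= t -> T s -> t < s ->
  (forall y, T y -> t < y -> s <= y) ->
  gexp T p s t = 1 + (s - t) * p t.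
Proof.
move=> Tt at_ Ts ts sy; rewrite /gexp dint_scattered//.
rewrite /grain (fjump_scattered _ s)// /xi.
have st0 : 0 < s - t by rewrite subr_gt0.
rewrite gt_eqF// divfK ?gt_eqF// lnK// posrE.
by have := mulr_ge0 (ltW st0) (p0 _ Tt at_); lra.
Qed.

End exponential.

(** * Gronwall's inequality on a time scale *)

Lemma le_expR_eps {R : realType} (x y c : R) : 0 <= y -> 0 <= c ->
  (forall eps, 0 < eps -> x <= expR (eps * c) * y) -> x <= y.
Proof.
move=> y0 c0 xy; rewrite leNgt; apply/negP => yx.
have x0 : 0 < x by exact: le_lt_trans yx.
have c1 : 0 < c + 1 by lra.
(* If [y < x], then [1 - eps * c <= expR (- (eps * c))] yields [x - y <= eps * c * x], which this
   choice makes smaller than [(x - y) / 2]. Using [c + 1] covers [c = 0]. *)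
have [eps eps0 epsE] : exists2 eps, 0 < eps & eps * (c + 1) * x = (x - y) / 2.
  exists ((x - y) / (2 * x * (c + 1))).
    by rewrite divr_gt0// ?subr_gt0// !mulr_gt0.
  by field; rewrite !gt_eqF.
have := xy _ eps0; set e := expR _ => L.
have e1 : (1 - eps * c) * e <= 1.
  rewrite -[leRHS](@mulVf _ e) ?gt_eqF ?expR_gt0//.
  by rewrite ler_pM2r ?expR_gt0// -expRN expR_ge1Dx.
have : (1 - eps * c) * x <= y.
  have [n0|n0] := leP 0 (1 - eps * c).
    apply: (le_trans (ler_wpM2l n0 L)).
    by rewrite mulrA ler_piMl.
  by apply: le_trans y0; rewrite mulr_le0_ge0// ltW.
have := mulr_gt0 eps0 x0; lra.
Qed.

(* One Euler step: if the rate stays within [eps / 4] of [p], then over a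
   short step [D] the growth of [m] is absorbed by the growth of the
   exponential times [expR (eps * D)]. *)
Lemma euler_step {R : realType} (eps p B D m0 m1 W X : R) :
  0 < eps -> 0 <= p -> p + eps / 4 <= B -> 0 < B ->
  0 < D -> D * (4 * B * (B + eps)) <= eps ->
  m1 <= m0 + (p + eps / 4) * m1 * D -> m0 <= W -> 0 <= W ->
  1 + (p - eps / 4) * D + eps * D <= X ->
  m1 <= W * X.
Proof.
move=> eps0 p0 pB B0 D0 DB up m0W W0 lo.
have Be : 0 < B + eps by lra.
set P := p + eps / 4 in pB up; set Q := p - eps / 4 + eps.
have P0 : 0 <= P by rewrite /P; lra.
have Q0 : 0 <= Q by rewrite /Q; lra.
have PQ : P * Q <= B * (B + eps).
  by apply: ler_pM => //; rewrite /P /Q in pB *; lra.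
(* The bound on [m1] is implicit; positivity of [1 - D * P] lets it be solved as
   [(1 - D * P) * m1 <= m0]. *)
have c0 : 0 < 1 - D * P.
  have DP : D * P <= D * B by rewrite ler_pM2l.
  suff : D * B * 4 < 1 by have := mulr_gt0 D0 B0; lra.
  by rewrite -(ltr_pM2r Be) mul1r; lra.
have DPQ : D * (P * Q) <= D * (B * (B + eps)) by rewrite ler_pM2l.
(* The product is [1 + D * (Q - P - D * P * Q)], where [Q - P = eps / 2] and the step restriction
   gives [D * P * Q <= eps / 4]. *)
have cY : 1 <= (1 - D * P) * (1 + D * Q).
  have : 0 <= D * (eps / 2 - D * (P * Q)) by rewrite mulr_ge0 ?(ltW D0)//; lra.
  by rewrite (_ : eps / 2 = Q - P); [lra|rewrite /P /Q; field].
rewrite -(ler_pM2l c0); apply: (@le_trans _ _ m0).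
  by move: up; lra.
apply: (le_trans m0W).
rewrite mulrCA; apply: ler_peMr => //; apply: (le_trans cY); rewrite ler_pM2l//.
by apply: le_trans lo; rewrite /Q; lra.
Qed.

Lemma delta_gronwall {R : realType} {T : set R} {a K : R} {p z : R -> R} :
  closed T -> T a -> rd_continuous [set t | T t /\ a <= t] p ->
  (forall t, T t -> a <= t -> 0 <= p t) ->
  locally_dint T a z -> (forall t, T t -> a <= t -> 0 <= z t) -> 0 <= K ->
  (forall t, T t -> a <= t -> z t <= K + dint T (p \* z) a t) ->
  forall t, T t -> a <= t -> z t <= K * gexp T p t a.
Proof.
move=> cT Ta rp p0 lz z0 K0 zK t0 Tt0 at0.
have lp := rd_continuous_locally_dint cT Ta _ rp.
have lpz := locally_dintM _ _ lp lz.
have lq := xi_locally_dint cT Ta lp p0.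
have pz0 t : T t -> a <= t -> 0 <= (p \* z) t by move=> *; rewrite mulr_ge0 ?p0 ?z0.
pose m t := K + dint T (p \* z) a t.
have mD s t : a <= s -> s <= t -> m t = m s + dint T (p \* z) s t.
  by move=> as_ st; rewrite /m (dint_cat cT Ta _ _ _ _ lpz _ as_ st)// addrA.
have m_homo s t : T s -> a <= s -> s <= t -> m s <= m t.
  move=> Ts as_ st; rewrite (mD s t)// lerDl (dint_ge0 cT Ta)//.
  by move=> y Ty sy; apply: pz0 => //; exact: le_trans sy.
have m0 t : a <= t -> 0 <= m t.
  move=> at_; rewrite (le_trans _ (m_homo a t Ta _ at_))// /m.
  by rewrite dint_nil addr0.
have zm t : T t -> a <= t -> z t <= m t by exact: zK.
have ma : m a = K by rewrite /m dint_nil addr0.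
pose E t := gexp T p t a.
have Ea : E a = 1 by rewrite /E /gexp dint_nil expR0.
have E_cat s t : a <= s -> s <= t -> E t = E s * gexp T p t s.
  exact: (gexp_cat cT Ta lp p0).
have E_homo s t : T s -> a <= s -> s <= t -> E s <= E t.
  exact: (gexp_homo cT Ta lp p0).
have E0 t : 0 <= E t by exact: expR_ge0.
(* A factor expR (eps * (t - a)) leaves room for the error made when the
   data are frozen to the right of a right-dense point. *)
suff mE eps : 0 < eps -> forall t, T t -> a <= t ->
    m t <= expR (eps * (t - a)) * (K * E t).
  apply: (le_trans (zm _ Tt0 at0)); apply: (@le_expR_eps _ _ _ (t0 - a)).
  - exact: mulr_ge0 K0 (E0 _).
  - by rewrite subr_ge0.
  - by move=> eps eps0; exact: mE.
clearbody m E; move=> eps0; apply: (time_scale_ind cT Ta).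
- by rewrite ma Ea subrr mulr0 expR0 mulr1 mul1r.
- move=> t s Tt at_ Ts ts sy IH; have lts := ltW ts.
  have mE : m s = m t + p t * z t * (s - t).
    by rewrite (mD t s)// dint_scattered.
  have EE : E s = E t * (1 + (s - t) * p t).
    by rewrite (E_cat t s)// (gexp_scattered p0).
  rewrite mE EE !mulrA -[_ * K * _]mulrA.
  have w0 : 0 <= (s - t) * p t by rewrite mulr_ge0 ?p0// subr_ge0.
  (* Over the jump [m] gains [p t * z t * (s - t)], and [z t <= m t]. *)
  apply: (@le_trans _ _ (m t * (1 + (s - t) * p t))).
    by have := ler_wpM2l w0 (zm _ Tt at_); lra.
  apply: ler_wpM2r; first by lra.
  apply: (le_trans IH); apply: ler_wpM2r; first by rewrite mulr_ge0.
  by rewrite ler_expR ler_pM2l// lerD2r.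
- move=> t Tt at_ rd IH.
  pose eta := eps / 4.
  have eta0 : 0 < eta by rewrite divr_gt0.
  have rdI : right_dense [set t | T t /\ a <= t] t.
    move=> e /rd[s [Ts [ts se]]]; exists s; split => //; split => //.
    exact: le_trans (ltW ts).
  have [d [d0 pd]] := (rp t (conj Tt at_)).1 rdI _ (divr_gt0 eta0 (ltr0Sn R 1)).
  pose B := p t + eta + 1.
  have B1 : 1 < B by have := p0 _ Tt at_; rewrite /B; lra.
  (* The three bounds keep [p] within [eta / 2] of [p t], make the error [grain T y * p y ^+ 2] of
     [xi_ge] at most [eta / 2], and meet the step restriction of [euler_step]. *)
  pose d' := Num.min d (Num.min (eta / (2 * B ^+ 2)) (eps / (4 * B * (B + eps)))).
  have B0 : 0 < B by lra.
  have Be : 0 < B + eps by lra.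
  have d'0 : 0 < d'.
    by rewrite !lt_min d0 !divr_gt0// ?mulr_gt0// exprn_gt0.
  have [d1 d2 d3] : [/\ d' <= d, d' * (2 * B ^+ 2) <= eta &
      d' * (4 * B * (B + eps)) <= eps].
    rewrite -!ler_pdivlMr ?mulr_gt0 ?exprn_gt0//.
    by split; rewrite !ge_min lexx ?orbT.
  have [s' [Ts' [ts' s'd]]] := rd d' d'0.
  exists (s' - t); split; first by rewrite subr_gt0.
  move=> s Ts ts ss'.
  have lts := ltW ts.
  have as_ : a <= s by rewrite (le_trans at_).
  have pnear y : T y -> t <= y -> y < s -> p t - eta / 2 <= p y <= p t + eta / 2.
    move=> Ty ty ys; have := pd y; rewrite /= => /(_ (conj Ty (le_trans at_ ty))).
    rewrite ger0_norm ?subr_ge0// => /(_ ltac:(lra)).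
    by rewrite ltr_norml => /andP[? ?]; apply/andP; split; lra.
  set D := s - t.
  have D0 : 0 < D by rewrite /D subr_gt0.
  have Dd : D < d' by rewrite /D; lra.
  (* On [[t, s[] the rate is at most [p t + eta], and [z <= m <= m s] by monotonicity of [m]. *)
  have up : m s <= m t + (p t + eta) * m s * D.
    rewrite {1}(mD t s)// lerD2l -(dint_cst (T := T))//.
    apply: (dint_le cT Ta) => //; first exact: cst_locally_dint.
    move=> y Ty ty ys /=; have ay := le_trans at_ ty.
    have /andP[_ py] := pnear y Ty ty ys.
    apply: ler_pM; [exact: p0|exact: z0|lra|].
    by apply: le_trans (zm _ Ty ay) _; apply: m_homo => //; exact: ltW.
  (* By [expR x >= 1 + x] and [xi_ge]: one [eta / 2] is lost to the variation of [p], the other to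
     the graininess. *)
  have lo : 1 + (p t - eta) * D + eps * D <= expR (eps * D) * gexp T p s t.
    rewrite /gexp -expRD; apply: le_trans (expR_ge1Dx _).
    rewrite -addrA lerD2l [leRHS]addrC lerD2r -(dint_cst (T := T))//.
    apply: (dint_le cT Ta) => //; first exact: cst_locally_dint.
    move=> y Ty ty ys /=; have ay := le_trans at_ ty.
    have /andP[py1 py2] := pnear y Ty ty ys.
    apply: le_trans _ (xi_ge _ _ (grain_ge0 y) (p0 _ Ty ay)).
    (* The jump from [y] cannot pass the point [s] of [T]. *)
    have gD : grain T y <= d'.
      by have := fjump_le _ _ Ts ys; rewrite /grain => ?; rewrite /D in Dd; lra.
    have pB : p y ^+ 2 <= B ^+ 2.
      by rewrite lerXn2r ?nnegrE ?p0//; [exact: ltW|rewrite /B; lra].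
    have := ler_pM (grain_ge0 y) (sqr_ge0 _) gD pB; lra.
  have pt0 := p0 _ Tt at_.
  have WE : expR (eps * (s - a)) * (K * E s) =
      expR (eps * (t - a)) * (K * E t) * (expR (eps * D) * gexp T p s t).
    rewrite (E_cat t s)//.
    rewrite (_ : eps * (s - a) = eps * (t - a) + eps * D); last by rewrite /D; ring.
    by rewrite expRD; ring.
  rewrite WE; apply: (@euler_step _ eps (p t) B D (m t)) => //.
  - by rewrite /B /eta; lra.
  - by apply: le_trans d3; rewrite ler_pM2r ?mulr_gt0// ltW.
  - by rewrite !mulr_ge0 ?expR_ge0.
- move=> t Tt at_ ld IH; rewrite leNgt; apply/negP.
  set W := expR _ * _ => lt; have lt_t := ltW at_.
  (* If [W < m t], pick [s < t] in [T] within [e] of [t]. Then [m t - m s <= C * e < m t - W],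
     contradicting [m s <= W]. The minimum with [t - a] ensures [a <= s]. *)
  have [C HC] := lpz.2 t.
  have C0 : 0 <= C by apply: le_trans (HC t Tt (ltW at_) (lexx _)).
  have C1 : 0 < C + 1 by lra.
  pose e := (m t - W) / (C + 1).
  have e0 : 0 < e by rewrite divr_gt0// subr_gt0.
  have eE : e * (C + 1) = m t - W by rewrite divfK// gt_eqF.
  have [|s [Ts [ts st]]] := ld (Num.min e (t - a)).
    by rewrite lt_min e0 subr_gt0.
  have se : t - e < s.
    by have : Num.min e (t - a) <= e by [rewrite ge_min lexx]; lra.
  have as_ : a <= s.
    by have : Num.min e (t - a) <= t - a by [rewrite ge_min lexx orbT]; lra.
  have sW : m s <= W.
    apply: (le_trans (IH s Ts as_ st)); rewrite /W.
    apply: ler_pM; rewrite ?mulr_ge0 ?expR_ge0//.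
      by rewrite ler_expR ler_pM2l// lerD2r ltW.
    apply: ler_wpM2l => //.
    by apply: E_homo => //; exact: ltW.
  have : dint T (p \* z) s t <= C * (t - s).
    have lst := ltW st; rewrite -(dint_cst (T := T))//.
    apply: (dint_le cT Ta) => //; first exact: cst_locally_dint.
    move=> y Ty sy yt; apply: le_trans (ler_norm _) _.
    by apply: HC => //; [exact: le_trans sy|exact: ltW].
  have : C * (t - s) <= C * e by rewrite ler_wpM2l//; lra.
  have := mD s t as_ (ltW st); lra.
Qed.

(** * The inequality with both a running and a fixed integral *)

Lemma rd_continuousD {R : realType} (D : set R) (f g : R -> R) :
  rd_continuous D f -> rd_continuous D g -> rd_continuous D (f \+ g).
Proof.
move=> rf rg t Dt; split=> [rd e e0|ld].
  have e2 : 0 < e / 2 by rewrite divr_gt0.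
  have [c [c0 fc]] := (rf t Dt).1 rd _ e2.
  have [d [d0 gd]] := (rg t Dt).1 rd _ e2.
  exists (Num.min c d); rewrite lt_min c0 d0; split => // s Ds.
  rewrite lt_min => /andP[sc sd] /=.
  rewrite opprD addrACA (le_lt_trans (ler_normD _ _))//.
  by have := fc s Ds sc; have := gd s Ds sd; lra.
have [l fl] := (rf t Dt).2 ld; have [k gk] := (rg t Dt).2 ld.
exists (l + k) => e e0; have e2 : 0 < e / 2 by rewrite divr_gt0.
have [c [c0 fc]] := fl _ e2; have [d [d0 gd]] := gk _ e2.
exists (Num.min c d); rewrite lt_min c0 d0; split => // s Ds.
rewrite ltrBlDl -ltrBlDr lt_min => /andP[sc sd] st /=.
rewrite opprD addrACA (le_lt_trans (ler_normD _ _))//.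
by have := fc s Ds ltac:(lra) st; have := gd s Ds ltac:(lra) st; lra.
Qed.

Theorem theorem3p2 (R : realType) (T : set R) (a b k : R) (u f g h : R -> R) :
  time_scale T -> T a -> T b -> a < b ->
  let I := [set t | T t /\ a <= t] in
  rd_continuous I u -> rd_continuous I f -> rd_continuous I g ->
  rd_continuous I h ->
  (forall t, I t -> 0 <= u t /\ 0 <= f t /\ 0 <= g t /\ 0 <= h t) ->
  0 <= k ->
  (forall t, I t ->
     u t <= k + dint T (fun s => f s * (u s + dint T (fun tau => g tau * u tau) a s
                                           + dint T (fun tau => h tau * u tau) a b)) a t) ->
  let r := dint T (fun tau => h tau * gexp T (f \+ g) tau a) a b in
  r < 1 ->
  forall t, I t -> u t <= k / (1 - r) * gexp T (f \+ g) t a.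
Proof.
move=> [_ cT] Ta Tb ab I ru rf rg rh pos k0 uk r r1 t [Tt at_].
have lab := ltW ab.
have u0 y : T y -> a <= y -> 0 <= u y by move=> Ty ay; case: (pos y (conj Ty ay)).
have f0 y : T y -> a <= y -> 0 <= f y.
  by move=> Ty ay; case: (pos y (conj Ty ay)) => _ [].
have g0 y : T y -> a <= y -> 0 <= g y.
  by move=> Ty ay; case: (pos y (conj Ty ay)) => _ [_ []].
have h0 y : T y -> a <= y -> 0 <= h y.
  by move=> Ty ay; case: (pos y (conj Ty ay)) => _ [_ []].
have lu := rd_continuous_locally_dint cT Ta _ ru.
have lf := rd_continuous_locally_dint cT Ta _ rf.
have lg := rd_continuous_locally_dint cT Ta _ rg.
have lh := rd_continuous_locally_dint cT Ta _ rh.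
have lgu := locally_dintM _ _ lg lu.
have lhu := locally_dintM _ _ lh lu.
have gu0 y : T y -> a <= y -> 0 <= (g \* u) y.
  by move=> Ty ay; rewrite mulr_ge0 ?g0 ?u0.
pose G := dint T (g \* u) a; pose H := dint T (h \* u) a b.
have lG : locally_dint T a G by exact: dint_locally_dint.
have G0 y : T y -> a <= y -> 0 <= G y by move=> Ty ay; exact: (dint_ge0 cT Ta).
have H0 : 0 <= H.
  by apply: (dint_ge0 cT Ta) => // y Ty ay; rewrite mulr_ge0 ?h0 ?u0.
pose z := u \+ G \+ cst H.
have lz : locally_dint T a z.
  by apply: locally_dintD; [exact: locally_dintD|exact: cst_locally_dint].
have z0 y : T y -> a <= y -> 0 <= z y.
  by move=> Ty ay; rewrite !addr_ge0 ?u0 ?G0.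
have uz y : T y -> a <= y -> u y <= z y.
  by move=> Ty ay; rewrite /z/= -addrA lerDl addr_ge0 ?G0.
(* The bracket in the hypothesis is [z] up to conversion. *)
have ukz y : T y -> a <= y -> u y <= k + dint T (f \* z) a y.
  by move=> Ty ay; exact: (uk y (conj Ty ay)).
have lfz := locally_dintM _ _ lf lz; have lgz := locally_dintM _ _ lg lz.
have lfgz : locally_dint T a ((f \+ g) \* z).
  by apply: locally_dintM => //; exact: locally_dintD.
have zK y : T y -> a <= y -> z y <= (k + H) + dint T ((f \+ g) \* z) a y.
  move=> Ty ay.
  have -> : (f \+ g) \* z = (f \* z) \+ (g \* z).
    by apply/funext => s; rewrite /= mulrDl.
  rewrite (dintD cT Ta)//.
  (* Replacing [u] by the larger [z] here turns the running integral into part of a single Gronwall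
     kernel [f \+ g]. *)
  have guz : G y <= dint T (g \* z) a y.
    apply: (dint_le cT Ta) => // s Ts as_ _.
    by apply: ler_wpM2l; [exact: g0|exact: uz].
  apply: le_trans (lerD (lerD (ukz y Ty ay) guz) (lexx H)) _.
  by rewrite [leRHS]addrAC addrA.
have rfg : rd_continuous I (f \+ g) by exact: rd_continuousD.
have fg0 y : T y -> a <= y -> 0 <= (f \+ g) y.
  by move=> Ty ay; rewrite addr_ge0 ?f0 ?g0.
have kH0 : 0 <= k + H by rewrite addr_ge0.
have uE y : T y -> a <= y -> u y <= (k + H) * gexp T (f \+ g) y a.
  move=> Ty ay; apply: le_trans (uz y Ty ay) _.
  exact: (delta_gronwall cT Ta rfg fg0 lz z0 kH0 zK).
have lE : locally_dint T a (gexp T (f \+ g) ^~ a).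
  by apply: gexp_locally_dint => //; exact: locally_dintD.
have Hr : H <= r * (k + H).
  have lhE := locally_dintM _ _ lh lE.
  rewrite /r -(dintZr cT Ta _ _ _ _ lhE)//.
  apply: (dint_le cT Ta) => //.
    by apply: locally_dintM => //; exact: cst_locally_dint.
  move=> y Ty ay _ /=; rewrite -mulrA; apply: ler_wpM2l; first exact: h0.
  by rewrite mulrC uE.
(* After clearing the denominator, positive since [r < 1], the remaining claim
   [k + H <= k / (1 - r)] is [Hr] rearranged. *)
apply: le_trans (uE t Tt at_) _; rewrite ler_wpM2r ?expR_ge0//.
rewrite ler_pdivlMr ?subr_gt0// mulrBr mulr1 [_ * r]mulrC.
by move: H r Hr {uk z lz z0 uz ukz lfz lgz lfgz zK kH0 uE H0 r1} => H' r' ?; lra.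
Qed.
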